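(* There exists a set $E\subset\mathbb{R}^2$ such that $0<\mathcal{H}^1(E)<\infty$, $E$ is $1$-rectifiable, and, for all $p>2$ (with $p<\infty$), $$\int_0^1\beta_{\mathcal{H}^1|_E,p}^1(x,r)^2\,\frac{dr}{r}=\infty\quad\text{for }\mathcal{H}^1\text{-a.e. }x\in E.$$
   Context: $\mathcal{H}^1$ denotes $1$-dimensional Hausdorff measure and $\mathcal{H}^1|_E$ its restriction to $E$. For a measure $\mu$ in $\mathbb{R}^2$, $1\leq p<\infty$, $x\in\mathbb{R}^2$ and $r>0$, with $B(x,r)$ the ball of center $x$ and radius $r$, define $$\beta_{\mu,p}^1(x,r)=\inf_{L\subset\mathbb{R}^2\text{ a line}}\left(\int_{B(x,r)}\left(\frac{\operatorname{dist}(y,L)}{r}\right)^p\,\frac{d\mu(y)}{r}\right)^{1/p},$$ where the infimum is over all (affine) lines. A Radon measure $\mu$ in $\mathbb{R}^2$ is $1$-rectifiable if there are Lipschitz maps $f_i:\mathbb{R}\to\mathbb{R}^2$, $i=1,2,\ldots$, such that $\mu(\mathbb{R}^2\setminus\bigcup_i f_i(\mathbb{R}))=0$, and $\mu$ is absolutely continuous with respect to $\mathcal{H}^1$. A set $E\subset\mathbb{R}^2$ is $1$-rectifiable if the measure $\mathcal{H}^1|_E$ is $1$-rectifiable. *)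

(* Defs.v *)
From HB Require Import structures.
From mathcomp Require Import all_boot all_order all_algebra.
From mathcomp Require Import all_classical all_reals all_analysis.

Set Implicit Arguments.
Unset Strict Implicit.
Unset Printing Implicit Defensive.
Import Order.TTheory GRing.Theory Num.Theory.
Import numFieldNormedType.Exports.
Local Open Scope classical_set_scope.
Local Open Scope ring_scope.

Notation plane R := (R * R)%type (only parsing).

Section euclidean_plane.
Context {R : realType}.
Implicit Types x y : plane R.

(* The library's norm on R * R is the sup norm, hence this definition. *)
Definition eudist x y : R :=
  Num.sqrt ((x.1 - y.1) ^+ 2 + (x.2 - y.2) ^+ 2).

Definition euball x (r : R) : set (plane R) := [set y | eudist x y < r].

Definition is_line (L : set (plane R)) : Prop :=
  exists a v : plane R,
    v != 0 /\ L = [set (a.1 + t * v.1, a.2 + t * v.2) | t in [set: R]].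

Definition dist_to y (L : set (plane R)) : R :=
  inf [set eudist y z | z in L].

Definition eulipschitz (f : R -> plane R) : Prop :=
  exists k : R, forall s t, eudist (f s) (f t) <= k * `|s - t|.

End euclidean_plane.

Section hausdorff_measure.
Context {R : realType}.
Local Open Scope ereal_scope.
Implicit Types (A U : set (plane R)) (delta : R).

(* The maximum with 0 only matters for the empty set. *)
Definition diam U : \bar R :=
  maxe 0 (ereal_sup [set (eudist p.1 p.2)%:E | p in U `*` U]).

Definition delta_cover delta A : set ((set (plane R))^nat) :=
  [set U | A `<=` \bigcup_k U k /\ forall k, diam (U k) <= delta%:E].

Definition hausdorff1_delta delta A : \bar R :=
  ereal_inf [set \sum_(k <oo) diam (U k) | U in delta_cover delta A].

Definition hausdorff1 A : \bar R :=
  ereal_sup [set hausdorff1_delta delta A | delta in [set d : R | (0 < d)%R]].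

Lemma diam_ge0 U : 0 <= diam U.
Proof. by rewrite /diam le_max lexx. Qed.

Lemma diam0 : diam set0 = 0.
Proof.
rewrite /diam set0X image_set0 ereal_sup0; apply/max_idPl; exact: leNye.
Qed.

Lemma hausdorff1_delta_ge0 delta A : 0 <= hausdorff1_delta delta A.
Proof.
apply: le_ereal_inf_tmp => x [U _ <-{x}].
by apply: nneseries_ge0 => n _ _; exact: diam_ge0.
Qed.

Lemma le_hausdorff1_delta delta :
  {homo hausdorff1_delta delta : A B / A `<=` B >-> A <= B}.
Proof.
move=> A B AB; apply/ereal_inf_le_tmp => x [U [BU Ud] <-{x}].
by exists U => //; split => //; exact: subset_trans AB BU.
Qed.

Lemma hausdorff1_delta_le delta A : (0 < delta)%R ->
  hausdorff1_delta delta A <= hausdorff1 A.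
Proof. by move=> d0; apply: ereal_sup_ubound; exists delta. Qed.

Lemma hausdorff1_ge0 A : 0 <= hausdorff1 A.
Proof.
apply: le_trans (hausdorff1_delta_ge0 1 A) _; exact: hausdorff1_delta_le.
Qed.

Lemma le_hausdorff1 : {homo hausdorff1 : A B / A `<=` B >-> A <= B}.
Proof.
move=> A B AB; apply: ge_ereal_sup => x [d d0 <-{x}].
apply: le_trans (le_hausdorff1_delta d AB) _; exact: hausdorff1_delta_le.
Qed.

Lemma hausdorff10 : hausdorff1 set0 = 0.
Proof.
apply/eqP; rewrite eq_le hausdorff1_ge0 andbT.
apply: ge_ereal_sup => x [d d0 <-{x}].
apply: ereal_inf_lbound; exists (fun=> set0).
  by split => // k; rewrite diam0 lee_fin ltW.
by rewrite eseries0// => k _ _; exact: diam0.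
Qed.

Lemma hausdorff1_delta_sigma_subadditive delta :
  sigma_subadditive (hausdorff1_delta delta).
Proof.
move=> A; have [[i ioo]|] :=
    pselect (exists i, hausdorff1_delta delta (A i) = +oo).
  rewrite (eseries_pinfty _ _ ioo) ?leey// => n _.
  by rewrite -ltNye (lt_le_trans _ (hausdorff1_delta_ge0 _ _)).
rewrite -forallNE => Aoo.
apply/lee_addgt0Pr => _/posnumP[e].
rewrite (le_trans _ (epsilon_trick _ _ _))//; last first.
  by move=> n; exact: hausdorff1_delta_ge0.
pose P n (U : (set (plane R))^nat) := delta_cover delta (A n) U /\
  \sum_(k <oo) diam (U k) <=
    hausdorff1_delta delta (A n) + (e%:num / (2 ^ n.+1)%:R)%:E.
have [G PG] : {G : ((set (plane R))^nat)^nat & forall n, P n (G n)}.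
  apply: (@choice _ _ P) => n; rewrite /P.
  have fin : hausdorff1_delta delta (A n) \is a fin_num.
    by rewrite ge0_fin_numE ?hausdorff1_delta_ge0// ltey; apply/eqP/Aoo.
  have en1 : (0 < e%:num / (2 ^ n.+1)%:R)%R by [].
  have [_ [U AU <-] Ulo] := lb_ereal_inf_adherent en1 fin.
  by exists U; split => //; exact/ltW.
have G_ge0 x : 0 <= (diam \o uncurry G) x by exact: diam_ge0.
apply: (@le_trans _ _ (\esum_(i in setT) (diam \o uncurry G) i)).
  apply: ereal_inf_lbound => /=.
  have /card_esym/ppcard_eqP[f] := card_nat2.
  exists (uncurry G \o f).
    split => [t [i _]|k]; last first.
      by rewrite /=; case: (f k) => a b; exact: (PG a).1.2.
    move=> /(PG i).1.1 [j _ Gijt]; exists (f^-1%FUN (i, j)) => //=.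
    by rewrite invK ?inE.
  rewrite -(esum_pred_image (diam \o uncurry G) _ xpredT) ?[fun=> _]set_true//.
  by rewrite image_eq.
rewrite (_ : esum _ _ = \sum_(i <oo) \sum_(j <oo ) diam (G i j)); last first.
  pose J : nat -> set (nat * nat) := fun i => [set (i, j) | j in setT].
  rewrite (_ : setT = \bigcup_k J k); last first.
    by rewrite predeqE => -[a b]; split => // _; exists a => //; exists b.
  rewrite esum_bigcupT /=; last 2 first.
    - apply/trivIsetP => i j _ _ ij.
      rewrite predeqE => -[n m] /=; split => //= -[] [_] _ [<-{n} _].
      by move=> [m' _] [] /esym/eqP; rewrite (negbTE ij).
    - by move=> /= [n m]; exact: diam_ge0.
  rewrite -(image_id [set: nat]) -fun_true esum_pred_image//; last first.
    by move=> n _; apply: esum_ge0 => m _; exact: diam_ge0.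
  apply: eq_eseriesr => /= j _.
  rewrite -(esum_pred_image (diam \o uncurry G) (pair j) predT)//=; last first.
    by move=> ? ? _ _; exact: (@can_inj _ _ _ snd).
    by move=> n _; exact: diam_ge0.
  by congr esum; rewrite predeqE => -[a b]; split; move=> [i _ <-]; exists i.
apply: lee_nneseries => [n _ _|n _]; last exact: (PG n).2.
by apply: nneseries_ge0 => m _ _; exact: diam_ge0.
Qed.

Lemma hausdorff1_sigma_subadditive : sigma_subadditive hausdorff1.
Proof.
move=> A; apply: ge_ereal_sup => x [d d0 <-{x}].
apply: le_trans (hausdorff1_delta_sigma_subadditive d A) _.
apply: lee_nneseries => [n _ _|n _]; first exact: hausdorff1_delta_ge0.
exact: hausdorff1_delta_le.
Qed.

HB.instance Definition _ := isOuterMeasure.Build R (plane R) hausdorff1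
  hausdorff10 hausdorff1_ge0 le_hausdorff1 hausdorff1_sigma_subadditive.

End hausdorff_measure.

Section restriction.
Context {R : realType}.
Local Open Scope ereal_scope.
Variables (mu : {outer_measure set (plane R) -> \bar R}) (E : set (plane R)).

Definition outer_restr (A : set (plane R)) : \bar R := mu (A `&` E).

Lemma outer_restr0 : outer_restr set0 = 0.
Proof. by rewrite /outer_restr set0I outer_measure0. Qed.

Lemma outer_restr_ge0 A : 0 <= outer_restr A.
Proof. exact: outer_measure_ge0. Qed.

Lemma le_outer_restr : {homo outer_restr : A B / A `<=` B >-> A <= B}.
Proof. by move=> A B AB; apply: le_outer_measure; exact: setSI. Qed.

Lemma outer_restr_sigma_subadditive : sigma_subadditive outer_restr.
Proof.
by move=> A; rewrite /outer_restr setI_bigcupl;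
  exact: outer_measure_sigma_subadditive.
Qed.

HB.instance Definition _ := isOuterMeasure.Build R (plane R) outer_restr
  outer_restr0 outer_restr_ge0 le_outer_restr outer_restr_sigma_subadditive.

End restriction.

Section rectifiability.
Context {R : realType}.
Local Open Scope ereal_scope.
Implicit Types (mu : {outer_measure set (plane R) -> \bar R}).

(* As usual in geometric measure theory, measures are defined on all subsets.
   [measurable] on R * R is the product sigma-algebra, that is, the Borel sets
   of the plane, and a Radon measure is a
   Borel regular outer measure which is finite on compact sets. *)
Definition radon mu : Prop :=
  [/\ measurable `<=` mu.-caratheodory,
      forall A, exists B, [/\ measurable B, A `<=` B & mu B = mu A] &
      forall K, compact K -> mu K < +oo].

Definition rectifiable_measure mu : Prop :=
  [/\ radon mu,
      exists f : nat -> R -> plane R, (forall i, eulipschitz (f i)) /\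
        mu (~` \bigcup_i range (f i)) = 0 &
      mu `<< hausdorff1].

Definition rectifiable_set (E : set (plane R)) : Prop :=
  rectifiable_measure (outer_restr hausdorff1 E).

(* The integral of the library depends only on the values of [mu] on Borel
   sets, so [mu] can be integrated against directly. *)
Definition beta mu (p : R) (x : plane R) (r : R) : \bar R :=
  ereal_inf [set poweR
    (\int[mu]_(y in euball x r) (((dist_to y L / r) `^ p)%:E * (r^-1)%:E)) p^-1
    | L in is_line].

End rectifiability.

(* Main.v *)
From HB Require Import structures.
Require Import Defs.
From mathcomp Require Import all_boot all_order all_algebra.
From mathcomp Require Import all_classical all_reals all_analysis.
From mathcomp Require Import measurable_realfun.
From mathcomp Require Import zify lra ring.
Import Order.TTheory GRing.Theory Num.Theory.
Import numFieldNormedType.Exports.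
Local Open Scope classical_set_scope.
Local Open Scope ring_scope.

Set Implicit Arguments.
Unset Strict Implicit.
Unset Printing Implicit Defensive.

(** The exponent 2 is the borderline because a piece of relative mass [eps]
    lying off a line at distance comparable to the scale contributes about
    [eps ^ (2 / p)] to the square of beta.  So one looks for a set that, at
    infinitely many scales around each of its points, carries such an extra
    piece, with relative masses [eps_m] such that [sum eps_m] converges, which
    keeps the length finite, while [sum eps_m ^ s] diverges for every [s < 1],
    in particular for [s = 2 / p].

    The set is a union of horizontal combs.  The comb of index [m] lies at
    height [height m] over the unit interval; it consists of [2 ^ m] teeth, one
    at the left end of each dyadic interval of length [pitch m = 2 ^ - m], and
    each tooth fills the proportion [density m] of its interval, so that the
    whole comb has length at most [density m].  The densities are differences
    of consecutive values of [1 / (1 + ln)]: their sum telescopes to at most 1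
    ([sum_density_le1]), and [density m ^ s] is at least a constant over [m]
    for every [s < 1] ([density_powR_ge]).

    Every point of the set has to see infinitely many extra pieces, including
    the points on the extra pieces themselves.  Hence every comb has a parent,
    the 2-adic valuation of its index, and hovers at height [pitch m] over it.
    The children of comb [n] are the indices [2 ^ n * (2 k + 1)], an arithmetic
    progression, over which the sum of [1 / m] still diverges.

    Let [x] lie on comb [n], let [m] be a child of [n] so late that comb [n]
    contains a segment of length [pitch m] starting at [x], and let the radius
    [r] be between [2 * pitch m] and [4 * pitch m].  The two outer thirds of
    that segment and the tooth of comb [m] near it form a nondegenerate
    triangle of size [pitch m], so each line keeps a distance comparable to
    [r] from all of one of the three ([far_from_line]).  Since all three have
    length at least [density m * pitch m / 3], beta is at least a constant
    times [density m ^ (1 / p)] ([beta_comb_set]).  The intervals of radii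
    belonging to different children are disjoint, and the integral dominates
    the divergent sum of [density m ^ (2 / p)] over the children
    ([comb_set_beta_infinite]).  This holds at all points of the set.

    Rectifiability is clear as regards the covering by Lipschitz curves, since
    the set lies on countably many lines.  What remains is that the length
    measure restricted to the set is a Radon measure: Borel sets are
    Caratheodory measurable because [hausdorff1] is additive on separated sets
    ([borel_caratheodory_hausdorff1]), and almost optimal covers can be
    replaced by Borel ones ([hausdorff1_borel_hull]). *)

(** * The Euclidean distance and diameters *)

Section distance.
Context {R : realType}.
Implicit Types x y z : R * R.

Lemma eudistC x y : eudist x y = eudist y x.
Proof. by rewrite /eudist -[x.1 - _]opprB -[x.2 - _]opprB !sqrrN. Qed.

Lemma ge_abs_eudist1 x y : `|x.1 - y.1| <= eudist x y.
Proof. by rewrite -sqrtr_sqr ler_wsqrtr// lerDl sqr_ge0. Qed.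

Lemma ge_abs_eudist2 x y : `|x.2 - y.2| <= eudist x y.
Proof. by rewrite -sqrtr_sqr ler_wsqrtr// lerDr sqr_ge0. Qed.

Lemma eudist_le_add x y : eudist x y <= `|x.1 - y.1| + `|x.2 - y.2|.
Proof.
rewrite -ler_sqr ?nnegrE ?addr_ge0// ?sqrtr_ge0//.
rewrite sqr_sqrtr ?addr_ge0 ?sqr_ge0// [leRHS]sqrrD !real_normK ?num_real//.
by rewrite lerD2r lerDl mulrn_wge0// mulr_ge0.
Qed.

Lemma eudist_ge0 x y : 0 <= eudist x y.
Proof. exact: sqrtr_ge0. Qed.

Lemma eudist_triangle y x z : eudist x z <= eudist x y + eudist y z.
Proof.
have sqE u v : eudist u v ^+ 2 = (u.1 - v.1) ^+ 2 + (u.2 - v.2) ^+ 2.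
  by rewrite sqr_sqrtr// addr_ge0 ?sqr_ge0.
rewrite -(@ler_pXn2r _ 2)// ?nnegrE ?addr_ge0 ?eudist_ge0// sqrrD !sqE.
set a := x.1 - y.1; set b := x.2 - y.2.
set c := y.1 - z.1; set d := y.2 - z.2.
have -> : x.1 - z.1 = a + c by rewrite /a /c; ring.
have -> : x.2 - z.2 = b + d by rewrite /b /d; ring.
(* Cauchy-Schwarz, by Lagrange's identity. *)
have CS : a * c + b * d <= eudist x y * eudist y z.
  rewrite (le_trans (ler_norm _))// -[leRHS]ger0_norm ?mulr_ge0 ?eudist_ge0//.
  rewrite -ler_sqr ?nnegrE// !real_normK ?num_real// exprMn !sqE.
  rewrite -/a -/b -/c -/d.
  by rewrite -subr_ge0; apply: le_trans (sqr_ge0 (a * d - b * c)) _; lra.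
by lra.
Qed.

End distance.

Section diameter.
Context {R : realType}.
Local Open Scope ereal_scope.
Implicit Types U V : set (R * R).

Lemma eudist_le_diam U x y : U x -> U y -> (eudist x y)%:E <= diam U.
Proof.
move=> Ux Uy; rewrite /diam le_max; apply/orP; right.
by apply: ereal_sup_ubound; exists (x, y).
Qed.

Lemma diam_leP U d : 0 <= d ->
  (forall x y, U x -> U y -> (eudist x y)%:E <= d) -> diam U <= d.
Proof.
move=> d0 Ud; rewrite /diam ge_max d0/=.
by apply: ge_ereal_sup => _ [[x y] [/= Ux Uy] <-]; exact: Ud.
Qed.

Lemma le_diam U V : U `<=` V -> diam U <= diam V.
Proof.
move=> UV; apply: diam_leP; first exact: diam_ge0.
by move=> x y Ux Uy; apply: eudist_le_diam; exact: UV.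
Qed.

Lemma hausdorff1_delta_anti (A : set (R * R)) (d e : R) : (d <= e)%R ->
  hausdorff1_delta e A <= hausdorff1_delta d A.
Proof.
move=> de; apply: ereal_inf_le_tmp => _ [U [AU Ud] <-]; exists U => //.
by split=> // k; rewrite (le_trans (Ud k))// lee_fin.
Qed.

(** A covering set of diameter less than [d] cannot meet both [A] and [B], so
    a fine cover of the union splits into a cover of [A] and a cover of [B]
    without any increase of the total diameter. *)
Lemma hausdorff1_separated (A B : set (R * R)) (d : R) : (0 < d)%R ->
  (forall a b, A a -> B b -> (d <= eudist a b)%R) ->
  hausdorff1 A + hausdorff1 B <= hausdorff1 (A `|` B).
Proof.
move=> d0 AB; have [->|fin] := eqVneq (hausdorff1 (A `|` B)) +oo.
  by rewrite leey.
have pieces (e f : R) : (0 < e)%R -> (0 < f)%R ->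
    hausdorff1_delta e A + hausdorff1_delta f B <= hausdorff1 (A `|` B).
  move=> e0 f0; pose g := Num.min (Num.min e f) (d / 2)%R.
  have g0 : (0 < g)%R by rewrite !lt_min e0 f0/= divr_gt0.
  have ge : (g <= e)%R by rewrite !ge_min lexx.
  have gf : (g <= f)%R by rewrite !ge_min lexx orbT.
  have gd : (g < d)%R by rewrite gt_min ltr_pdivrMr// ltr_pMr// ltr1n orbT.
  apply: le_trans (hausdorff1_delta_le _ g0).
  apply: le_trans (leeD (hausdorff1_delta_anti A ge)
                        (hausdorff1_delta_anti B gf)) _.
  apply: le_ereal_inf_tmp => _ [U [ABU Ug] <-].
  have cut C : C `<=` \bigcup_k U k ->
      hausdorff1_delta g C <= \sum_(k <oo) diam (U k `&` C).
    move=> CU; apply: ereal_inf_lbound; exists (fun k => U k `&` C) => //.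
    split=> [x Cx|k]; first by have [k _ Ukx] := CU x Cx; exists k.
    by apply: le_trans (Ug k); exact: le_diam.
  apply: le_trans (leeD (cut A _) (cut B _)) _.
  - by move=> x Ax; apply: ABU; left.
  - by move=> x Ax; apply: ABU; right.
  rewrite -nneseriesD; [|by move=> *; exact: diam_ge0..].
  apply: lee_nneseries => [n _ _|n _]; first by rewrite adde_ge0 ?diam_ge0.
  have [[x [Ux Ax]]|/nonemptyPn->] := pselect (U n `&` A !=set0); last first.
    by rewrite diam0 add0e le_diam.
  have [[y [Uy By]]|/nonemptyPn->] := pselect (U n `&` B !=set0); last first.
    by rewrite diam0 adde0 le_diam.
  have := le_trans (eudist_le_diam Ux Uy) (Ug n).
  by rewrite lee_fin leNgt (lt_le_trans gd) ?AB.
(* The two suprema over the mesh are taken one after the other. *)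
have finAB : hausdorff1 (A `|` B) \is a fin_num.
  by rewrite ge0_fin_numE ?hausdorff1_ge0// ltey.
have finA : hausdorff1 A \is a fin_num.
  rewrite ge0_fin_numE ?hausdorff1_ge0//.
  by rewrite (le_lt_trans (le_hausdorff1 (@subsetUl _ A B)))// ltey.
rewrite addeC -leeBrDr//; apply: ge_ereal_sup => _ [f f0 <-].
rewrite leeBrDr// addeC.
have finB : hausdorff1_delta f B \is a fin_num.
  rewrite ge0_fin_numE ?hausdorff1_delta_ge0//.
  rewrite (le_lt_trans (hausdorff1_delta_le B f0))//.
  by rewrite (le_lt_trans (le_hausdorff1 (@subsetUr _ A B)))// ltey.
rewrite -leeBrDr//; apply: ge_ereal_sup => _ [e e0 <-].
by rewrite leeBrDr// pieces.
Qed.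

End diameter.

(** * Borel sets are Caratheodory measurable *)

Section level_sets.
Local Open Scope ereal_scope.

(** Caratheodory's criterion for metric outer measures, in the form needed
    for a single function [g].  With [T_ n = X `&` {g > 1 / (n + 1)}], the set
    [T_ n] is separated from [X `\` {g > 0}], and the only question is whether
    [mu (T_ n)] tends to [mu (X `&` {g > 0})].  The shell [S (n + 1)] between
    [T_ (n + 1)] and [T_ (n + 2)] is separated from [T_ n], hence its measure
    is at most [mu (T_ (n + 2)) - mu (T_ n)]; these bounds telescope, the
    measures of the shells are summable, and their tails tend to 0. *)
Lemma caratheodory_superlevel (R : realType) (T : Type)
    (mu : {outer_measure set T -> \bar R}) (g : T -> R) :
  (forall (A B : set T) (d : R), (0 < d)%R ->
    (forall a b, A a -> B b -> (d <= `|g a - g b|)%R) ->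
    mu A + mu B <= mu (A `|` B)) ->
  mu.-caratheodory [set x | (0 < g x)%R].
Proof.
move=> sep; apply: le_caratheodory_measurable => X; set C := [set x | _].
have [->|finX] := eqVneq (mu X) +oo; first by rewrite leey.
have {}finX : mu X < +oo by rewrite ltey.
pose a n : R := (n.+1%:R^-1)%R; pose T_ n := X `&` [set x | (a n < g x)%R].
pose S n := T_ n.+1 `\` T_ n.
have a_gt0 n : (0 < a n)%R by rewrite invr_gt0 ltr0n.
have a_dec n : (a n.+1 < a n)%R.
  by rewrite ltf_pV2 ?posrE ?ltr0n// ltr_nat.
have TX n : T_ n `<=` X by move=> x [].
have step n : mu (T_ n) + mu (S n.+1) <= mu (T_ n.+2).
  apply: le_trans (sep _ _ (a n - a n.+1)%R _ _) _.
  - by rewrite subr_gt0.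
  - move=> x y [_ /= gx] [[Xy _] nTy].
    have gy : (g y <= a n.+1)%R by rewrite leNgt; apply/negP => gy; exact: nTy.
    rewrite ger0_norm; first by rewrite lerB// ltW.
    by rewrite subr_ge0 (le_trans gy)// (le_trans (ltW (a_dec n)))// ltW.
  - apply: le_outer_measure => x [[Xx /= gx]|[[]]//]; split=> //=.
    by rewrite (lt_trans _ gx)// (lt_trans (a_dec _)).
have sumS N : \sum_(0 <= n < N) mu (S n.+1) <= mu X + mu X.
  apply: (@le_trans _ _ (mu (T_ N) + mu (T_ N.+1))); last first.
    by rewrite leeD// le_outer_measure.
  elim: N => [|N IH]; first by rewrite big_nil adde_ge0 ?outer_measure_ge0.
  rewrite big_nat_recr//=; apply: le_trans (leeD2r _ IH) _.
  by rewrite addeAC addeC leeD2l.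
have S0 n : 0 <= mu (S n.+1) by exact: outer_measure_ge0.
have cvgS : \sum_(0 <= n <oo) mu (S n.+1) < +oo.
  apply: (@le_lt_trans _ _ (mu X + mu X)); last by rewrite lte_add_pinfty.
  apply: lime_le; first by apply: is_cvg_nneseries => *.
  by apply: nearW => N; exact: sumS.
have tail := nneseries_tail_cvg cvgS (fun n _ => S0 n).
have bound n : mu (X `&` C) + mu (X `&` ~` C) <=
    mu X + \sum_(n <= k <oo) mu (S k.+1).
  have cover : X `&` C `<=`
      T_ n.+1 `|` \bigcup_(k in [set k | (n <= k)%N]) S k.+1.
    move=> x [Xx /= gx0].
    have [agx|gxa] := ltP (a n.+1) (g x); first by left; split.
    right.
    have ex : exists k, (a k < g x)%R.
      exists (Num.truncn (g x)^-1); rewrite /a invf_plt ?posrE ?ltr0n//.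
      by rewrite truncnS_gt.
    case: (ex_minnP ex) => m am min_m.
    have nm : (n.+1 < m)%N.
      by have := lt_le_trans am gxa; rewrite ltf_pV2 ?posrE ?ltr0n// ltr_nat.
    case: m nm am min_m => [//|[//|m]] nm am min_m.
    exists m => //; split; first by split.
    by move=> [_ /=] /min_m; rewrite ltnn.
  have muC : mu (X `&` C) <= mu (T_ n.+1) + \sum_(n <= k <oo) mu (S k.+1).
    apply: le_trans (le_outer_measure mu _ _ cover) _.
    apply: le_trans (outer_measureU2 mu _ _) _; rewrite leeD2l//.
    rewrite (_ : \bigcup_(k in _) _ = \bigcup_k S (k + n)%N.+1); last first.
      apply/seteqP; split=> x [k /= nk Sx]; last first.
        by exists (k + n)%N => //=; rewrite leq_addl.
      by exists (k - n)%N => //; rewrite subnK.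
    apply: le_trans (outer_measure_sigma_subadditive mu _) _.
    by rewrite -(nneseries_addn n S0).
  apply: le_trans (leeD2r _ muC) _; rewrite addeAC leeD2r//.
  apply: le_trans (sep _ _ _ (a_gt0 n.+1) _) _.
    move=> x y [_ /= gx] [_ /= /negP]; rewrite -leNgt => gy.
    by rewrite ger0_norm; [lra|have := a_gt0 n.+1; lra].
  by apply: le_outer_measure => x [/TX|[]].
have lim : mu X + \sum_(n <= k <oo) mu (S k.+1) @[n --> \oo] --> mu X + 0.
  apply: cvgeD; first by rewrite fin_num_adde_defl.
    exact: cvg_cst.
  exact: tail.
by rewrite adde0 in lim; apply: cvge_to_ge lim _; exact: nearW.
Qed.

End level_sets.

Section borel_sets.
Context {R : realType}.
Local Open Scope ereal_scope.

Lemma caratheodory_hausdorff1_lipschitz (g : R * R -> R) :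
  (forall x y, (`|g x - g y| <= eudist x y)%R) ->
  hausdorff1.-caratheodory [set x | (0 < g x)%R].
Proof.
move=> g1; apply: caratheodory_superlevel => A B d d0 AB.
apply: (hausdorff1_separated d0) => a b Aa Bb.
by apply: le_trans (g1 a b); exact: AB.
Qed.

(** The Borel sets of the plane are generated by the half-planes bounded by
    vertical or horizontal lines, which are superlevel sets of the coordinates,
    functions of Lipschitz constant 1. *)
Lemma borel_caratheodory_hausdorff1 :
  (measurable : set (set (R * R))) `<=` hausdorff1.-caratheodory.
Proof.
pose U := caratheodory_type (@hausdorff1 R).
have coord (f : U -> R) : (forall x y, (`|f x - f y| <= eudist x y)%R) ->
    forall B, measurable B -> hausdorff1.-caratheodory (f @^-1` B).
  move=> f1 B mB; suff mf : measurable_fun [set: U] f.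
    by have := mf measurableT _ mB; rewrite setTI.
  apply: (measurability _ (RGenOInfty.measurableE R)) => _ [_ [a ->] <-].
  rewrite setTI (_ : _ @^-1` _ = [set x | (0 < f x - a)%R]).
    apply: caratheodory_hausdorff1_lipschitz => x y.
    by rewrite opprB addrA subrK.
  by apply/seteqP; split=> x /=; rewrite in_itv/= andbT subr_gt0.
apply: smallest_sub; first exact: (@sigma_algebra_measurable _ U).
move=> _ [[B mB <-]|[B mB <-]]; rewrite setTI; apply: coord => // x y.
- exact: ge_abs_eudist1.
- exact: ge_abs_eudist2.
Qed.

End borel_sets.

Section outer_restriction.
Context {R : realType}.
Local Open Scope ereal_scope.
Variable E : set (R * R).

Lemma borel_caratheodory_outer_restr :
  (measurable : set (set (R * R))) `<=`
    (outer_restr hausdorff1 E).-caratheodory.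
Proof.
move=> B mB X; rewrite /outer_restr ![X `&` _ `&` E]setIAC.
exact: (borel_caratheodory_hausdorff1 mB).
Qed.

Lemma outer_restr_semi_sigma_additive :
  semi_sigma_additive (outer_restr hausdorff1 E : set (R * R) -> \bar R).
Proof.
move=> F mF tF mUF.
apply: (@caratheodory_measure_sigma_additive _ _
  (outer_restr hausdorff1 E)) => //.
- by move=> i; exact: borel_caratheodory_outer_restr.
- exact: borel_caratheodory_outer_restr.
Qed.

(** Being additive on Borel sets, the restricted outer measure inherits the
    theory of integration with respect to measures. *)
HB.instance Definition _ := isMeasure.Build _ (R * R)%type R
  (outer_restr hausdorff1 E : set (R * R) -> \bar R)
  (outer_restr0 _ _) (outer_restr_ge0 _ _) outer_restr_semi_sigma_additive.

End outer_restriction.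

(** * Length of horizontal segments *)

Section segments.
Context {R : realType}.
Local Open Scope ereal_scope.

(** The shadow of [U] on the horizontal axis lies between its infimum and its
    supremum, whose difference is at most the diameter; this bounds lengths
    from below by one-dimensional Lebesgue measure. *)
Lemma shadow_le_diam (U : set (R * R)) : diam U < +oo ->
  exists J : set R, [/\ measurable J, U `<=` fst @^-1` J &
    lebesgue_measure J <= diam U].
Proof.
move=> Uoo; have [U0|/nonemptyPn->] := pselect (U !=set0); last first.
  by exists set0; split; rewrite ?measure0 ?diam_ge0.
have dE : diam U = (fine (diam U))%:E.
  by rewrite fineK// ge0_fin_numE// diam_ge0.
move: dE; set d := fine _ => dE.
pose P : set R := fst @` U.
have Pd x y : P x -> P y -> (x - y <= d)%R.
  move=> [u Uu <-] [v Uv <-].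
  rewrite (le_trans (ler_norm _))// (le_trans (ge_abs_eudist1 _ _))//.
  by rewrite -lee_fin -dE eudist_le_diam.
have [u Uu] := U0.
have Pu : P u.1 by exists u.
have ubP : has_ubound P.
  by exists (d + u.1)%R => x Px; rewrite -lerBlDr Pd.
have lbP : has_lbound P.
  by exists (u.1 - d)%R => x Px; have := Pd _ _ Pu Px; lra.
exists `[inf P, sup P]%classic; split => //.
- move=> v Uv /=; rewrite in_itv/= ge_inf ?ub_le_sup//; by exists v.
- rewrite lebesgue_measure_itv/= dE; case: ifP => _; last first.
    by rewrite -dE diam_ge0.
  rewrite -EFinB lee_fin lerBlDr; apply: ge_sup; first by exists u.1.
  move=> x Px; rewrite addrC -lerBlDr; apply: lb_le_inf => [|y Py].
    by exists u.1.
  by rewrite lerBlDr -lerBlDl Pd.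
Qed.

Lemma hausdorff1_ge_segment (a b y : R) : (a <= b)%R ->
  (b - a)%:E <= hausdorff1 (`[a, b[ `*` [set y]).
Proof.
move=> ab; apply: le_trans (hausdorff1_delta_le _ ltr01).
apply: le_ereal_inf_tmp => _ [U [IU U1] <-].
have {}U1 k : diam (U k) < +oo by apply: le_lt_trans (U1 k) _; rewrite ltey.
pose J k := sval (cid (shadow_le_diam (U1 k))).
have JP k : [/\ measurable (J k), U k `<=` fst @^-1` J k &
    lebesgue_measure (J k) <= diam (U k)] by rewrite /J; case: cid.
have -> : (b - a)%:E = lebesgue_measure (`[a, b[%classic : set R).
  rewrite lebesgue_measure_itv/= lte_fin; case: ltP => //= ba.
  by rewrite (_ : b = a) ?subrr//; apply/eqP; rewrite eq_le ab ba.
apply: (@le_trans _ _ (\sum_(k <oo) lebesgue_measure (J k))).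
  apply: measure_sigma_subadditive => //; first by move=> k; case: (JP k).
  move=> t It; have [|k _ Ukt] := IU (t, y); first by split.
  by exists k => //; case: (JP k) => _ /(_ _ Ukt).
apply: lee_nneseries => [*|k _]; first exact: measure_ge0.
by case: (JP k).
Qed.

Lemma hausdorff1_le_segment (a b y : R) : (a <= b)%R ->
  hausdorff1 (`[a, b[ `*` [set y]) <= (b - a)%:E.
Proof.
move=> ab; apply: ge_ereal_sup => _ [d d0 <-].
pose n := Num.truncn ((b - a) / d)%R; pose h : R := ((b - a) / n.+1%:R)%R.
have h0 : (0 <= h)%R by rewrite divr_ge0// subr_ge0.
have hd : (h <= d)%R.
  by rewrite ler_pdivrMr ?ltr0n// mulrC -ler_pdivrMr// ltW// truncnS_gt.
pose V k : set (R * R) := `[(a + k%:R * h)%R, (a + k.+1%:R * h)%R[ `*` [set y].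
have Vh k : diam (V k) <= h%:E.
  apply: diam_leP; first by rewrite lee_fin.
  move=> [u1 u2] [v1 v2] [/= + ->] [/= + ->].
  rewrite !in_itv/= -!natr1 !mulrDl !mul1r => ? ?.
  rewrite lee_fin (le_trans (eudist_le_add _ _))//= subrr normr0 addr0.
  by rewrite ler_norml; lra.
pose U k := if (k < n.+1)%N then V k else set0.
apply: (@le_trans _ _ (\sum_(k <oo) diam (U k))).
  apply: ereal_inf_lbound; exists U => //; split.
    move=> [t z] [/= + ->]; rewrite in_itv/= => /andP[at_ tb].
    have ba : (0 < b - a)%R by rewrite subr_gt0 (le_lt_trans at_).
    have hgt0 : (0 < h)%R by rewrite divr_gt0.
    have tr := @truncn_itv R ((t - a) / h)%R.
    have /tr/andP[k1 k2] : (0 <= (t - a) / h)%R by rewrite divr_ge0 ?subr_ge0.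
    exists (Num.truncn ((t - a) / h)%R) => //; rewrite /U ifT; last first.
      rewrite truncn_lt_nat ?divr_ge0 ?subr_ge0//.
      rewrite ltr_pdivrMr// /h mulrC divfK ?pnatr_eq0//; lra.
    split => //=; rewrite in_itv/=.
    move: k1 k2; rewrite ler_pdivlMr// ltr_pdivrMr//; lra.
  move=> k; rewrite /U; case: ifP => _; last by rewrite diam0 lee_fin ltW.
  by apply: le_trans (Vh k) _; rewrite lee_fin.
rewrite (nneseries_split 0 n.+1)//; last by move=> *; exact: diam_ge0.
rewrite eseries0 ?adde0; last first.
  by move=> k nk _; rewrite /U ltnNge -ltnS add0n in nk *; rewrite nk diam0.
rewrite add0n (@le_trans _ _ (\sum_(0 <= k < n.+1) h%:E))//.
  apply: lee_sum => k _; rewrite /U; case: ifP => // _.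
  by rewrite diam0 lee_fin.
rewrite sumEFin lee_fin big_const_nat subn0 iter_addr_0 -mulr_natr.
by rewrite /h divfK// pnatr_eq0.
Qed.

End segments.

(** * Borel hulls and rectifiability *)

Section grid_enlargement.
Context {R : realType}.
Local Open Scope ereal_scope.

(** The union of the cells of a fine square grid that meet [U] is a countable
    union of rectangles, and its diameter exceeds that of [U] by at most twice
    the diameter of a cell. *)
Lemma borel_enlargement (U : set (R * R)) (e : R) : (0 < e)%R ->
  exists V, [/\ measurable V, U `<=` V & diam V <= diam U + e%:E].
Proof.
move=> e0; pose h : R := (e / 4)%R; have h0 : (0 < h)%R by rewrite divr_gt0.
pose I (i : int) : set R := `[(i%:~R * h)%R, ((i + 1)%:~R * h)%R[%classic.
pose cell (q : int * int) : set (R * R) := I q.1 `*` I q.2.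
pose D := [set q | U `&` cell q !=set0].
exists (\bigcup_q (if q \in D then cell q else set0)); split.
- apply: countable_bigcupT_measurable; first exact: countableP.
  move=> q; case: ifP => _; last exact: measurable0.
  by apply: measurableX; exact: measurable_itv.
- move=> u Uu; pose i t := Num.floor (t / h)%R.
  have It t : I (i t) t.
    have := floor_itv (t / h)%R.
    by rewrite /I/= in_itv/= ler_pdivlMr// ltr_pdivrMr.
  exists (i u.1, i u.2) => //; rewrite ifT; first by split; exact: It.
  by rewrite inE; exists u; split => //; split; exact: It.
- apply: diam_leP; first by rewrite adde_ge0 ?diam_ge0// lee_fin ltW.
  have near v : (\bigcup_q (if q \in D then cell q else set0)) v ->
      exists2 u, U u & (eudist v u <= e / 2)%R.
    move=> [q _]; case: ifPn => //; rewrite inE => -[u [Uu cu]] cv.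
    exists u => //; apply: le_trans (eudist_le_add _ _) _.
    move: cu cv; rewrite /cell /I /= => -[/= + +] [/= + +].
    rewrite !in_itv/= !intrD !mulrDl !mul1r => u1 u2 v1 v2.
    have hE : (e / 2 = h + h)%R by rewrite /h; lra.
    by rewrite hE lerD// ler_norml; lra.
  move=> v w /near[u Uu vu] /near[t Ut wt].
  apply: (@le_trans _ _ ((eudist u t)%:E + e%:E)); last first.
    by rewrite leeD2r// eudist_le_diam.
  rewrite -EFinD lee_fin; have := eudist_triangle u v w.
  have := eudist_triangle t u w; rewrite (eudistC t w); lra.
Qed.

End grid_enlargement.

Section borel_hull.
Context {R : realType}.
Local Open Scope ereal_scope.

(** The parameter doubles because a covering set of diameter at most [d] is
    enlarged by up to [d]. *)
Lemma hausdorff1_delta_hull (A : set (R * R)) (d : R) : (0 < d)%R ->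
  hausdorff1 A < +oo -> exists B, [/\ measurable B, A `<=` B &
    hausdorff1_delta (d + d) B <= hausdorff1 A + (d + d)%:E].
Proof.
move=> d0 finA.
have fin : hausdorff1_delta d A \is a fin_num.
  rewrite ge0_fin_numE ?hausdorff1_delta_ge0//.
  exact: le_lt_trans (hausdorff1_delta_le A d0) finA.
have [_ [U [AU Ud] <-] Usum] := lb_ereal_inf_adherent d0 fin.
have e0 k : (0 < d / (2 ^ k.+1)%:R)%R by rewrite divr_gt0// ltr0n expn_gt0.
pose V k := sval (cid (borel_enlargement (U k) (e0 k))).
have VP k : [/\ measurable (V k), U k `<=` V k &
    diam (V k) <= diam (U k) + (d / (2 ^ k.+1)%:R)%:E] by rewrite /V; case: cid.
exists (\bigcup_k V k); split.
- by apply: bigcupT_measurable => k; case: (VP k).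
- by apply: subset_trans AU _; apply: subset_bigcup => k _; case: (VP k).
- apply: (@le_trans _ _ (\sum_(k <oo) diam (V k))).
    apply: ereal_inf_lbound; exists V => //; split => // k.
    case: (VP k) => _ _ /le_trans; apply; rewrite EFinD leeD//.
    rewrite lee_fin ler_pdivrMr ?ltr0n ?expn_gt0// ler_peMr ?(ltW d0)//.
    by rewrite ler1n expn_gt0.
  apply: (@le_trans _ _ (\sum_(k <oo) (diam (U k) + (d / (2 ^ k.+1)%:R)%:E))).
    apply: lee_nneseries => [k _ _|k _]; first exact: diam_ge0.
    by case: (VP k).
  apply: le_trans (epsilon_trick _ _ (ltW d0)) _.
    by move=> k; exact: diam_ge0.
  rewrite EFinD addeA leeD2r// (le_trans (ltW Usum))// leeD2r//.
  exact: hausdorff1_delta_le.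
Qed.

(** Intersecting the hulls for meshes that tend to 0 gives a hull for all
    meshes at once. *)
Lemma hausdorff1_borel_hull (A : set (R * R)) :
  exists B, [/\ measurable B, A `<=` B & hausdorff1 B = hausdorff1 A].
Proof.
have [Aoo|/negP finA] := eqVneq (hausdorff1 A) +oo.
  exists setT; split => //; apply/eqP; rewrite Aoo -leye_eq -Aoo.
  exact: le_hausdorff1.
have {}finA : hausdorff1 A < +oo by rewrite ltey; apply/negP.
have d0 n : (0 < n.+1%:R^-1 :> R)%R by rewrite invr_gt0.
pose V n := sval (cid (hausdorff1_delta_hull (d0 n) finA)).
have VP n : [/\ measurable (V n), A `<=` V n &
    hausdorff1_delta (n.+1%:R^-1 + n.+1%:R^-1) (V n) <=
    hausdorff1 A + (n.+1%:R^-1 + n.+1%:R^-1)%:E] by rewrite /V; case: cid.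
exists (\bigcap_n V n); split.
- by apply: bigcapT_measurable => n; case: (VP n).
- by move=> x Ax n _; case: (VP n) => _ AV _; exact: AV.
- apply/eqP; rewrite eq_le [X in _ && X]le_hausdorff1 ?andbT; last first.
    by move=> x Ax n _; case: (VP n) => _ AV _; exact: AV.
  apply: ge_ereal_sup => _ [d dgt0 <-]; apply/lee_addgt0Pr => e egt0.
  pose m := Num.min d e.
  have m0 : (0 < m)%R by rewrite lt_min dgt0.
  pose n := Num.truncn (2 / m)%R.
  have nm : (n.+1%:R^-1 + n.+1%:R^-1 <= m)%R.
    have : (2 / m < n.+1%:R)%R by rewrite truncnS_gt.
    rewrite ltr_pdivrMr// => h.
    have -> : (n.+1%:R^-1 + n.+1%:R^-1 = 2 / n.+1%:R :> R)%R by ring.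
    by rewrite ler_pdivrMr ?ltr0n// mulrC ltW.
  have [_ _ hV] := VP n.
  apply: le_trans (hausdorff1_delta_anti _ (le_trans nm _)) _.
    by rewrite ge_min lexx.
  apply: le_trans (le_hausdorff1_delta _ (@bigcap_inf _ _ n setT V I)) _.
  apply: le_trans hV _; rewrite leeD2l// lee_fin (le_trans nm)//.
  by rewrite ge_min lexx orbT.
Qed.

End borel_hull.

Section rectifiability.
Context {R : realType}.
Local Open Scope ereal_scope.

(** A Borel hull of [A] for the restriction to [E] is a Borel hull of
    [A `&` E] together with the complement of [E]. *)
Lemma radon_outer_restr (E : set (R * R)) : measurable E ->
  hausdorff1 E < +oo -> radon (outer_restr hausdorff1 E).
Proof.
move=> mE finE; split.
- exact: borel_caratheodory_outer_restr.
- move=> A; have [B [mB AEB BE]] := hausdorff1_borel_hull (A `&` E).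
  exists (B `|` ~` E); split.
  + by apply: measurableU => //; exact: measurableC.
  + by move=> x Ax; have [Ex|] := pselect (E x); [left; exact: AEB|right].
  + change (hausdorff1 ((B `|` ~` E) `&` E) = hausdorff1 (A `&` E)).
    apply/eqP; rewrite eq_le -BE; apply/andP; split.
      by apply: le_hausdorff1 => x [[]].
    rewrite BE; apply: le_hausdorff1 => x [Ax Ex].
    by split => //; left; exact: AEB.
- move=> K _; apply: le_lt_trans finE; apply: le_hausdorff1; exact: subIsetr.
Qed.

Lemma rectifiable_set_of_cover (E : set (R * R)) (f : nat -> R -> R * R) :
  measurable E -> hausdorff1 E < +oo -> (forall i, eulipschitz (f i)) ->
  E `<=` \bigcup_i range (f i) -> rectifiable_set E.
Proof.
move=> mE finE flip Ef; split; first exact: radon_outer_restr.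
- exists f; split => //; rewrite /= /outer_restr (_ : _ `&` _ = set0).
    exact: hausdorff10.
  by apply/seteqP; split=> // x [nfx /Ef].
- move=> N N0 A mA AN; apply/eqP; rewrite eq_le outer_restr_ge0 andbT.
  by rewrite -(N0 A mA AN); apply: le_hausdorff1; exact: subIsetl.
Qed.

End rectifiability.

(** * Lower bounds for integrals and for beta *)

Section lower_integral_bounds.
Context d (T : measurableType d) (R : realType).
Variable mu : {measure set T -> \bar R}.
Local Open Scope ereal_scope.

(** Monotonicity is immediate from the definition of the integral as a
    supremum over simple functions.  The point of this form is that it applies
    to beta as a function of the radius without a proof that it is
    measurable. *)
Lemma le_nonmeasurable_integral (f g : T -> \bar R) :
  (forall x, 0 <= f x) -> (forall x, f x <= g x) ->
  \int[mu]_x f x <= \int[mu]_x g x.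
Proof.
move=> f0 fg; have g0 x : 0 <= g x by exact: le_trans (f0 x) (fg x).
rewrite !ge0_integralTE//; apply: ereal_sup_le => _ [h hf <-].
by exists h => // x; exact: le_trans (hf x) (fg x).
Qed.

Lemma integral_ge_sum (D : set T) (f : T -> \bar R) (F : (set T)^nat)
    (c : nat -> R) (n : nat) :
  (forall x, D x -> 0 <= f x) ->
  (forall k, measurable (F k)) -> (forall k, F k `<=` D) -> trivIset setT F ->
  (forall k, (0 <= c k)%R) -> (forall k x, F k x -> (c k)%:E <= f x) ->
  \sum_(k < n) (c k)%:E * mu (F k) <= \int[mu]_(x in D) f x.
Proof.
move=> f0 mF FD tF c0 cf; rewrite integral_mkcond.
pose h k x : \bar R := (c k)%:E * (\1_(F k) x)%:E.
have mc k : measurable_fun setT (h k).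
  by apply: measurable_funeM; apply/measurable_EFinP; exact: measurable_indic.
have h0 k x : 0 <= h k x.
  by rewrite /h -EFinM lee_fin mulr_ge0.
have -> : \sum_(k < n) (c k)%:E * mu (F k) = \int[mu]_x \sum_(k < n) h k x.
  rewrite (@ge0_integral_sum _ _ _ mu setT measurableT _
    (fun k : 'I_n => h k))//.
  apply: eq_bigr => k _; rewrite ge0_integralZl//.
  - by rewrite integral_indic// setIT.
  - by apply/measurable_EFinP; exact: measurable_indic.
  - by rewrite lee_fin.
apply: le_nonmeasurable_integral => x; first exact: sume_ge0.
(* By disjointness, at most one term of the sum is nonzero at [x]. *)
have fD : 0 <= (f \_ D) x by exact: erestrict_ge0.
have [[k Fkx]|noF] := pselect (exists k : 'I_n, F k x); last first.
  rewrite big1// => k _; rewrite /h indicE memNset ?mule0//.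
  by move=> Fkx; apply: noF; exists k.
rewrite (bigD1 k)//= big1 ?adde0 => [|j jk].
  rewrite /h indicE mem_set// mule1 patchE mem_set; first exact: cf.
  exact: FD Fkx.
rewrite /h indicE memNset ?mule0// => Fjx.
have /trivIsetP/(_ j k I I) := tF; rewrite -val_eqE in jk.
by move=> /(_ jk) /seteqP[+ _] => /(_ x); apply.
Qed.

Lemma integral_ge_const (D B : set T) (f : T -> \bar R) (c : R) :
  (forall x, D x -> 0 <= f x) -> measurable B -> B `<=` D -> (0 <= c)%R ->
  (forall x, B x -> c%:E <= f x) ->
  c%:E * mu B <= \int[mu]_(x in D) f x.
Proof.
move=> f0 mB BD c0 cf.
have := @integral_ge_sum D f (fun k => if k is 0%N then B else set0)
  (fun=> c) 1%N f0.
rewrite big_ord1; apply => //.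
- by case=> [|k]; [exact: mB|exact: measurable0].
- by case=> [|k]; [exact: BD|exact: sub0set].
- by apply/trivIsetP => -[|i] [|j] _ _ //; rewrite ?setI0 ?set0I.
- by case=> [|k] x //; exact: cf.
Qed.

End lower_integral_bounds.

Section distance_to_lines.
Context {R : realType}.
Implicit Types (y z : R * R) (L : set (R * R)).

Lemma dist_to_ltP y L (d : R) : is_line L -> dist_to y L < d ->
  exists2 w, L w & eudist y w < d.
Proof.
move=> [a [v [_ LE]]] /inf_lt[|_ [w Lw <-] yw]; last by exists w.
exists (eudist y a), a => //; rewrite LE; exists 0 => //.
by rewrite !mul0r !addr0; case: a {LE}.
Qed.

Lemma dist_to_ge0 y L : 0 <= dist_to y L.
Proof.
have [->|/set0P[z Lz]] := eqVneq L set0.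
  by rewrite /dist_to image_set0 inf0.
apply: lb_le_inf => [|_ [w _ <-]]; last exact: eudist_ge0.
by exists (eudist y z), z.
Qed.

(** If the line came closer than [rho / 20] to all three points, it would
    contain points [w1], [w2], [w3] as close to [z1], [z2], [q].  The cross
    product of [w2 - w1] and [w3 - w1] vanishes by collinearity, yet its first
    term, horizontal times vertical component, is at least
    [0.21 * rho ^+ 2], and its second term is below [0.15 * rho ^+ 2]. *)
Lemma far_from_line L (rho : R) z1 z2 q : is_line L -> 0 < rho ->
  z1.2 = z2.2 -> rho / 3 <= z2.1 - z1.1 ->
  q.2 = z1.2 + rho -> `|q.1 - z1.1| <= rho * (4 / 3) ->
  [\/ rho / 20 <= dist_to z1 L, rho / 20 <= dist_to z2 L |
      rho / 20 <= dist_to q L].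
Proof.
move=> lineL rho0 z12 z21 q2 q1.
have [|/dist_to_ltP near1] := leP (rho / 20) (dist_to z1 L).
  by constructor 1.
have [|/dist_to_ltP near2] := leP (rho / 20) (dist_to z2 L).
  by constructor 2.
have [|/dist_to_ltP nearq] := leP (rho / 20) (dist_to q L).
  by constructor 3.
exfalso; have {near1}[w1 Lw1 d1] := near1 lineL.
have {near2}[w2 Lw2 d2] := near2 lineL; have {nearq}[w3 Lw3 d3] := nearq lineL.
have [a [v [_ LE]]] := lineL; rewrite LE in Lw1 Lw2 Lw3.
have coord y w : eudist y w < rho / 20 ->
    (y.1 - rho / 20 < w.1 < y.1 + rho / 20) /\
    (y.2 - rho / 20 < w.2 < y.2 + rho / 20).
  move=> yw; have := le_lt_trans (ge_abs_eudist1 y w) yw.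
  have := le_lt_trans (ge_abs_eudist2 y w) yw.
  by rewrite !ltr_norml; lra.
have {d1}[x1 y1] := coord _ _ d1; have {d2}[x2 y2] := coord _ _ d2.
have {d3}[x3 y3] := coord _ _ d3.
have col : (w2.1 - w1.1) * (w3.2 - w1.2) = (w2.2 - w1.2) * (w3.1 - w1.1).
  by case: Lw1 Lw2 Lw3 => [t _ <-] [u _ <-] [s _ <-] /=; ring.
move: q1; rewrite ler_norml => q1.
have A : rho * (7 / 30) <= w2.1 - w1.1 by lra.
have D : rho * (9 / 10) <= w3.2 - w1.2 by lra.
have B : `|w2.2 - w1.2| <= rho / 10 by rewrite ler_norml; lra.
have C : `|w3.1 - w1.1| <= rho * (43 / 30) by rewrite ler_norml; lra.
have AD : (rho * (7 / 30)) * (rho * (9 / 10)) <=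
    (w2.1 - w1.1) * (w3.2 - w1.2) by rewrite ler_pM//; lra.
have BC : (w2.2 - w1.2) * (w3.1 - w1.1) <= (rho / 10) * (rho * (43 / 30)).
  by rewrite (le_trans (ler_norm _))// normrM ler_pM.
have : 0 < rho * rho by rewrite mulr_gt0.
lra.
Qed.

End distance_to_lines.

Section beta_lower_bound.
Context {R : realType}.
Local Open Scope ereal_scope.

(** For the lower bound one may use a different piece [B] of the ball for each
    line, as long as the bounds on its mass and distance are uniform. *)
Lemma beta_ge (E : set (R * R)) (p r a m : R) (x : R * R) :
  (0 < p)%R -> (0 < r)%R -> (0 <= a)%R -> (0 <= m)%R ->
  (forall L, is_line L -> exists B, [/\ measurable B, B `<=` euball x r,
     m%:E <= hausdorff1 (B `&` E) & forall y, B y -> (a <= dist_to y L)%R]) ->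
  (((a / r) `^ p * r^-1 * m) `^ p^-1)%:E <=
    beta (outer_restr hausdorff1 E) p x r.
Proof.
move=> p0 r0 a0 m0 linesB; apply: le_ereal_inf_tmp => _ [L lineL <-].
have [B [mB Br mBE Ba]] := linesB L lineL.
have c0 : (0 <= (a / r) `^ p * r^-1)%R.
  by rewrite mulr_ge0 ?powR_ge0// invr_ge0 ltW.
rewrite -poweR_EFin; apply: gt0_ler_poweR; first by rewrite invr_ge0 ltW.
- by rewrite in_itv/= leey andbT lee_fin mulr_ge0.
- rewrite in_itv/= leey andbT; apply: integral_ge0 => y _.
  by rewrite -EFinM lee_fin mulr_ge0 ?powR_ge0// invr_ge0 ltW.
apply: (@le_trans _ _ (((a / r) `^ p * r^-1)%:E * outer_restr hausdorff1 E B)).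
  by rewrite EFinM lee_wpmul2l.
apply: integral_ge_const => // [y _|y By].
  by rewrite -EFinM lee_fin mulr_ge0 ?powR_ge0// invr_ge0 ltW.
rewrite -EFinM lee_fin ler_wpM2r ?invr_ge0 ?(ltW r0)//.
rewrite ge0_ler_powR ?(ltW p0)// ?nnegrE ?divr_ge0 ?dist_to_ge0 ?(ltW r0)//.
by rewrite ler_wpM2r ?invr_ge0 ?(ltW r0)// Ba.
Qed.

End beta_lower_bound.

(** * A summable sequence with divergent powers *)

Section density.
Context {R : realType}.

Definition loginv (m : nat) : R := (1 + ln m.+1%:R)^-1.

Definition density (m : nat) : R := loginv m - loginv m.+1.

Lemma onelog_ge1 (m : nat) : 1 <= 1 + ln m.+1%:R :> R.
Proof. by rewrite lerDl ln_ge0// ler1n. Qed.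

Lemma loginv_gt0 m : 0 < loginv m.
Proof. by rewrite invr_gt0 (lt_le_trans ltr01)// onelog_ge1. Qed.

Lemma loginv_le1 m : loginv m <= 1.
Proof. by rewrite invf_le1 ?onelog_ge1// (lt_le_trans ltr01)// onelog_ge1. Qed.

Lemma density_gt0 m : 0 < density m.
Proof.
rewrite subr_gt0 ltf_pV2 ?posrE ?(lt_le_trans ltr01 (onelog_ge1 _))//.
by rewrite ltrD2l ltr_ln ?posrE ?ltr0n// ltr_nat.
Qed.

Lemma density_le1 m : density m <= 1.
Proof.
by have := loginv_le1 m; have := loginv_gt0 m.+1; rewrite /density; lra.
Qed.

Lemma sum_density_le1 n : \sum_(0 <= m < n) density m <= 1.
Proof.
rewrite -[leLHS]opprK -sumrN (eq_bigr (fun m => loginv m.+1 - loginv m)).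
  rewrite telescope_sumr// opprB.
  by have := loginv_le1 0; have := loginv_gt0 n; lra.
by move=> m _; rewrite opprB.
Qed.

(** From [ln y < y] for [y] a small power of [x]. *)
Lemma onelog_le_powR (del x : R) : 0 < del -> 1 <= x ->
  1 + ln x <= (1 + del^-1) * x `^ del.
Proof.
move=> del0 x1; have x0 : 0 < x by exact: lt_le_trans ltr01 x1.
have xd1 : 1 <= x `^ del.
  by rewrite -(powRr0 x); apply: ler_powR => //; exact: ltW.
have := ln_sublinear (lt_le_trans ltr01 xd1); rewrite ln_powR => /ltW ld.
rewrite mulrDl mul1r lerD// -[leLHS](mulKf (lt0r_neq0 del0)).
by rewrite ler_wpM2l// invr_ge0 ltW.
Qed.

(** A discrete form of the derivative of [1 / (1 + ln x)]. *)
Lemma density_ge (m : nat) :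
  m.+2%:R^-1 / (1 + ln m.+2%:R) ^+ 2 <= density m.
Proof.
have m0 : (0 : R) < m.+1%:R by rewrite ltr0n.
have m1 : (0 : R) < m.+2%:R by rewrite ltr0n.
have l1 := onelog_ge1 m; have l2 := onelog_ge1 m.+1.
have step : m.+2%:R^-1 <= ln m.+2%:R - ln m.+1%:R :> R.
  rewrite -ln_div ?posrE// -lerN2 -lnV ?posrE ?divr_gt0// invf_div.
  have -> : m.+1%:R / m.+2%:R = 1 + - m.+2%:R^-1 :> R.
    have -> : m.+1%:R = m.+2%:R - 1 :> R by rewrite -[m.+2%:R]natr1 addrK.
    by field; rewrite gt_eqF.
  apply: le_ln1Dx; rewrite ltrN2 invf_lt1// ltr1n//.
have -> : density m = (ln m.+2%:R - ln m.+1%:R) *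
    ((1 + ln m.+1%:R)^-1 * (1 + ln m.+2%:R)^-1).
  by rewrite /density /loginv; field; apply/andP; split; apply: lt0r_neq0; lra.
apply: ler_pM => //; first by rewrite invr_ge0 sqr_ge0.
rewrite expr2 invfM ler_wpM2r ?invr_ge0 ?(le_trans ler01)//.
rewrite lef_pV2 ?posrE ?(lt_le_trans ltr01)//.
by rewrite lerD2l ler_ln ?posrE// ler_nat.
Qed.

(** The squared logarithm in [density_ge] costs an arbitrarily small power
    [del] of [m], which is available because [s < 1]; [del] is chosen such that
    the resulting exponent of [m] is exactly [- 1]. *)
Lemma density_powR_ge (s : R) : 0 < s < 1 ->
  exists2 c : R, 0 < c & forall m, c / m.+2%:R <= density m `^ s.
Proof.
move=> /andP[s0 s1]; pose del := (s^-1 - 1) / 2.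
have del0 : 0 < del by rewrite divr_gt0// subr_gt0 invf_gt1.
have K0 : 0 < 1 + del^-1 by rewrite addr_gt0// invr_gt0.
exists (((1 + del^-1) ^- 2) `^ s).
  by rewrite powR_gt0// invr_gt0 exprn_gt0.
move=> m; set x : R := m.+2%:R.
have x1 : 1 <= x by rewrite ler1n.
have x0 : 0 < x by exact: lt_le_trans ltr01 x1.
have dens : (1 + del^-1) ^- 2 * x `^ (- s^-1) <= density m.
  apply: le_trans (density_ge m); rewrite -/x.
  have -> : x `^ (- s^-1) = x^-1 / (x `^ del) ^+ 2.
    rewrite -powR_mulrn ?powR_ge0// -powRrM -[x^-1]powR_inv1 ?(ltW x0)// -powRN.
    rewrite -powRD ?(gt_eqF x0) ?implybT//; congr (_ `^ _); rewrite /del; lra.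
  rewrite mulrCA ler_wpM2l ?invr_ge0 ?(ltW x0)//.
  rewrite -invfM -exprMn.
  rewrite lef_pV2 ?posrE ?exprn_gt0 ?mulr_gt0 ?powR_gt0//; last first.
    exact: lt_le_trans ltr01 (onelog_ge1 _).
  rewrite ler_pXn2r ?nnegrE ?mulr_ge0 ?(ltW K0) ?powR_ge0 ?onelog_le_powR//.
  exact: le_trans ler01 (onelog_ge1 _).
have := ge0_ler_powR (ltW s0) _ _ dens; rewrite !nnegrE.
rewrite mulr_ge0 ?invr_ge0 ?exprn_ge0 ?powR_ge0 ?(ltW K0)//.
rewrite (ltW (density_gt0 m)).
move=> /(_ isT isT); rewrite powRM ?powR_ge0 ?invr_ge0 ?exprn_ge0 ?(ltW K0)//.
by rewrite -powRrM mulNr mulVf ?gt_eqF// powR_inv1// ltW.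
Qed.

End density.

Section harmonic_blocks.
Context {R : realType}.

Lemma harmonic_block_unbounded (A : R) (K : nat) :
  exists n : nat, A <= \sum_(k < n) (k + K).+1%:R^-1.
Proof.
have nd : nondecreasing_seq (series (@harmonic R)).
  by apply: nondecreasing_series => k _ _; rewrite invr_ge0.
have /cvgryPge/(_ (A + series (@harmonic R) K)) :=
  nondecreasing_dvgn_lt nd (@dvg_harmonic R).
move=> [N _ /(_ (N + K)%N (leq_addr _ _))]; rewrite /= -lerBrDr.
rewrite sub_series_geq ?leq_addl// => AN; exists N.
rewrite (le_trans AN)// -{1}(add0n K) big_addn addnK big_mkord.
by apply: ler_sum => k _.
Qed.

End harmonic_blocks.

(** * Genealogy and heights of the combs *)

Section heights.
Context {R : realType}.

Definition parent (m : nat) : nat := logn 2 m.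

Lemma parent_lt m : (0 < m)%N -> (parent m < m)%N.
Proof. by move=> m0; exact: ltn_logl. Qed.

(** Recursion along [parent], which is not structural; a bound on its length
    makes it so, and the index itself is large enough a bound. *)
Fixpoint height_upto (fuel m : nat) : R :=
  if fuel is f.+1 then
    if m == 0%N then 0 else height_upto f (parent m) + 2^-1 ^+ m
  else 0.

Definition height m := height_upto m m.

Lemma height_upto_stable f g m : (m <= f)%N -> (m <= g)%N ->
  height_upto f m = height_upto g m.
Proof.
elim: f g m => [|f IH] [|g] m //=; rewrite ?leqn0.
- by move=> /eqP->.
- by move=> _ /eqP->.
- move=> mf mg; case: eqP => // /eqP; rewrite -lt0n => m0.
  by rewrite (IH g)// -ltnS (leq_trans (parent_lt m0)).
Qed.

Lemma heightE m : (0 < m)%N -> height m = height (parent m) + 2^-1 ^+ m.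
Proof.
case: m => // m _; rewrite /height/=; congr (_ + _).
by apply: height_upto_stable => //; rewrite -ltnS parent_lt.
Qed.

Definition child (n k : nat) : nat := (2 ^ n * k.*2.+1)%N.

Lemma parent_child n k : parent (child n k) = n.
Proof.
rewrite /parent /child lognM ?expn_gt0// pfactorK// [X in (_ + X)%N]lognE.
by rewrite dvdn2/= odd_double/= addn0.
Qed.

Lemma child_gt n k : (k < child n k)%N.
Proof.
apply: leq_trans (leq_pmull _ _); last by rewrite expn_gt0.
by rewrite ltnS -addnn leq_addr.
Qed.

Lemma child_lt n j k : (j < k)%N -> (child n j < child n k)%N.
Proof. by move=> jk; rewrite ltn_pmul2l ?expn_gt0// ltnS ltn_double. Qed.

Lemma child_le n k : ((child n k).+2 <= 2 ^ n.+2 * k.+1)%N.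
Proof.
rewrite /child !expnS; have : (0 < 2 ^ n)%N by rewrite expn_gt0.
move: (2 ^ n)%N => a a0; rewrite -mul2n; nia.
Qed.

End heights.

(** * The union of combs *)

Section combs.
Context {R : realType}.

Definition pitch (m : nat) : R := 2^-1 ^+ m.

Definition tooth (m j : nat) : set R :=
  `[j%:R * pitch m, (j%:R + density m) * pitch m[%classic.

Definition comb (m : nat) : set R := \bigcup_(j in `I_(2 ^ m)) tooth m j.

Definition comb_set : set (R * R) := \bigcup_m (comb m `*` [set height m]).

Lemma pitch_gt0 m : 0 < pitch m.
Proof. by rewrite exprn_gt0// invr_gt0. Qed.

Lemma pitchS m : pitch m = 2 * pitch m.+1.
Proof. by rewrite /pitch exprS mulrA divff ?mul1r. Qed.

Lemma pitch_le m n : (m <= n)%N -> pitch n <= pitch m.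
Proof. by move=> mn; rewrite ler_wiXn2l// ?invr_ge0// invf_le1// ler1n. Qed.

Lemma pitch_cells m : (2 ^ m)%:R * pitch m = 1 :> R.
Proof. by rewrite natrX -exprMn divff// expr1n. Qed.

Lemma comb_sub01 m : comb m `<=` `[0, 1[.
Proof.
move=> t [j /= jm]; rewrite /tooth /= !in_itv/= => /andP[jt tj].
rewrite (le_trans _ jt)/=; last by rewrite mulr_ge0// ltW// pitch_gt0.
rewrite (lt_le_trans tj)// -[leRHS](pitch_cells m) ler_pM2r ?pitch_gt0//.
rewrite (@le_trans _ _ (j.+1%:R))// ?ler_nat//.
by rewrite -[j.+1%:R]natr1 lerD2l density_le1.
Qed.

Lemma measurable_comb m : measurable (comb m).
Proof. by apply: bigcup_measurable => j _; exact: measurable_itv. Qed.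

Lemma measurable_comb_set : measurable comb_set.
Proof.
apply: bigcupT_measurable => m; apply: measurableX; last exact: measurable_set1.
exact: measurable_comb.
Qed.

Lemma tooth_length m j :
  (j%:R + density m) * pitch m - j%:R * pitch m = density m * pitch m :> R.
Proof. by rewrite -mulrBl addrC addKr. Qed.

Lemma tooth_le m j : j%:R * pitch m <= (j%:R + density m) * pitch m :> R.
Proof. by rewrite ler_pM2r ?pitch_gt0// lerDl ltW// density_gt0. Qed.

Lemma hausdorff1_comb m (y : R) :
  (hausdorff1 (comb m `*` [set y]) <= (density m)%:E)%E.
Proof.
rewrite (_ : _ `*` _ = \big[setU/set0]_(j < 2 ^ m) (tooth m j `*` [set y])).
  apply: le_trans.
    exact: outer_measure_subadditive _ (fun j => tooth m j `*` [set y]) _.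
  apply: (@le_trans _ _ (\sum_(j < 2 ^ m) (density m * pitch m)%:E)%E).
    apply: lee_sum => j _; rewrite -(tooth_length m j).
    exact: hausdorff1_le_segment (tooth_le m j).
  rewrite sumEFin sumr_const card_ord -mulrnAr -[pitch m *+ _]mulr_natl.
  by rewrite pitch_cells mulr1.
rewrite -(bigcup_mkord _ (fun j => tooth m j `*` [set y])).
apply/seteqP; split=> [[t z] [[j jm tj] zy]|[t z] [j jm [tj zy]]].
  by exists j.
by split=> //; exists j.
Qed.

Lemma hausdorff1_comb_set_finite : (hausdorff1 comb_set < +oo)%E.
Proof.
apply: (@le_lt_trans _ _ 1%E); last exact: ltry.
apply: le_trans (outer_measure_sigma_subadditive _ _) _.
apply: (@le_trans _ _ (\sum_(m <oo) (density m)%:E)%E).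
  apply: lee_nneseries => [m _ _|m _]; first exact: hausdorff1_ge0.
  exact: hausdorff1_comb.
apply: lime_le.
  by apply: is_cvg_nneseries => m _ _; rewrite lee_fin ltW// density_gt0.
by apply: nearW => n; rewrite sumEFin lee_fin sum_density_le1.
Qed.

Lemma hausdorff1_comb_set_gt0 : (0 < hausdorff1 comb_set)%E.
Proof.
apply: (@lt_le_trans _ _ (density 0 * pitch 0)%:E).
  by rewrite lte_fin mulr_gt0 ?density_gt0 ?pitch_gt0.
rewrite -(tooth_length 0 0).
apply: le_trans (hausdorff1_ge_segment (height 0) (tooth_le 0 0)) _.
apply: le_hausdorff1 => -[t y] [/= tI ->].
by exists 0%N => //; split=> //; exists 0%N.
Qed.

Lemma rectifiable_comb_set : rectifiable_set comb_set.
Proof.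
apply: (@rectifiable_set_of_cover _ _ (fun m t => (t, height m))).
- exact: measurable_comb_set.
- exact: hausdorff1_comb_set_finite.
- move=> m; exists 1 => s t; apply: le_trans (eudist_le_add _ _) _.
  by rewrite /= subrr normr0 addr0 mul1r.
- by move=> [t y] [m _ [/= _ ->]]; exists m => //; exists t.
Qed.

(** Thanks to the half-open teeth, every point of a comb is the left end of a
    segment of the comb, so that no exceptional set arises. *)
Lemma comb_right_nbhd m t : comb m t ->
  exists2 e : R, 0 < e & `[t, t + e[ `<=` comb m.
Proof.
move=> [j jm]; rewrite /tooth/= in_itv/= => /andP[jt tj].
exists ((j%:R + density m) * pitch m - t); first by rewrite subr_gt0.
move=> s /=; rewrite in_itv/= => /andP[ts st]; exists j => //.
by rewrite /tooth/= in_itv/=; lra.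
Qed.

Lemma comb_tooth_near m (t : R) : 0 <= t < 1 ->
  exists2 a : R, a <= t < a + pitch m &
    `[a, a + density m * pitch m[ `<=` comb m.
Proof.
move=> /andP[t0 t1]; have p0 := pitch_gt0 m.
have tp0 : 0 <= t / pitch m by rewrite divr_ge0// ltW.
pose j := Num.truncn (t / pitch m).
have /andP[j1 j2] := truncn_itv tp0.
exists (j%:R * pitch m).
  move: j1 j2; rewrite -/j ler_pdivlMr// ltr_pdivrMr// -[j.+1%:R]natr1.
  by rewrite mulrDl mul1r => -> ->.
rewrite -mulrDl => s sI; exists j => //=.
rewrite truncn_lt_nat// ltr_pdivrMr//.
by rewrite pitch_cells.
Qed.

(** The constants come from the distance [pitch m / 20] of [far_from_line],
    from [r < 4 * pitch m], and from the mass [density m * pitch m / 3]. *)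
Lemma beta_comb_set (p : R) (n m : nat) (t r : R) :
  0 < p -> (0 < m)%N -> parent m = n -> comb n t ->
  `[t, t + pitch m[ `<=` comb n -> 2 * pitch m <= r < 4 * pitch m ->
  ((((80^-1) `^ p / 12 * density m) `^ p^-1)%:E <=
    beta (outer_restr hausdorff1 comb_set) p (t, height n) r)%E.
Proof.
move=> p0 m0 pm nt tn /andP[r2 r4]; have rho0 := pitch_gt0 m.
have d0 := @density_gt0 R m; have d1 := @density_le1 R m.
have r0 : 0 < r by lra.
set rho := pitch m in rho0 r2 r4 tn *.
have [a /andP[at1 at2] am] : exists2 a : R, a <= t < a + rho &
    `[a, a + density m * rho[ `<=` comb m.
  by apply: comb_tooth_near; have := comb_sub01 nt; rewrite /= in_itv.
have hm : height m = height n + rho :> R by rewrite heightE// pm.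
have drho0 : 0 < density m * rho by rewrite mulr_gt0.
have drho1 : density m * rho <= rho by rewrite ler_piMl// ltW.
pose mass : R := density m * rho / 3.
apply: le_trans (beta_ge (a := rho / 20) (m := mass) p0 r0 _ _ _); last first.
- move=> L lineL.
  have segment k (b c : R) : b <= c -> mass <= c - b -> `[b, c[ `<=` comb k ->
      (mass%:E <= hausdorff1 ((`[b, c[ `*` [set height k]) `&` comb_set))%E.
    move=> bc mbc Ik; rewrite setIidl; last first.
      by move=> [s y] [/= /Ik ? ->]; exists k.
    by apply: le_trans (hausdorff1_ge_segment _ bc); rewrite lee_fin.
  have meas k (b c : R) : measurable (`[b, c[ `*` [set height k] : set (R * R)).
    by apply: measurableX; [exact: measurable_itv|exact: measurable_set1].
  have inball (y : R * R) : `|t - y.1| + `|height n - y.2| < 2 * rho ->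
      euball (t, height n) r y.
    move=> ty; apply: le_lt_trans (eudist_le_add _ _) _.
    exact: lt_le_trans ty r2.
  pose J1 : set (R * R) := `[t, t + rho / 3[ `*` [set height n].
  pose J2 : set (R * R) := `[t + rho * (2 / 3), t + rho[ `*` [set height n].
  pose Q : set (R * R) := `[a, a + density m * rho[ `*` [set height m].
  (* [far_from_line] is applied to points [z1], [z2], [q] of these pieces; if
     the first two pieces fail for [L], the third one cannot fail. *)
  have [far1|/existsNP[z1 /not_implyP[[z1t z1h] near1]]] :=
      pselect (forall y, J1 y -> rho / 20 <= dist_to y L).
    exists J1; split => //.
    + exact: meas.
    + move=> [s y] [/= + ->]; rewrite in_itv/= => st; apply: inball => /=.
      by rewrite subrr normr0 addr0 ltr_norml; lra.
    + apply: segment; [lra|rewrite /mass; lra|].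
      move=> s; rewrite /= in_itv/= => st.
      by apply: tn; rewrite /= in_itv/=; lra.
  have [far2|/existsNP[z2 /not_implyP[[z2t z2h] near2]]] :=
      pselect (forall y, J2 y -> rho / 20 <= dist_to y L).
    exists J2; split => //.
    + exact: meas.
    + move=> [s y] [/= + ->]; rewrite in_itv/= => st; apply: inball => /=.
      by rewrite subrr normr0 addr0 ltr_norml; lra.
    + apply: segment; [lra|rewrite /mass; lra|].
      move=> s; rewrite /= in_itv/= => st.
      by apply: tn; rewrite /= in_itv/=; lra.
  exists Q; split => //.
  + exact: meas.
  + move=> [s y] [/= + ->]; rewrite in_itv/= => st; apply: inball => /=.
    rewrite hm opprD addNKr normrN (gtr0_norm rho0) mulrDl mul1r ltrD2r.
    by rewrite ltr_norml; lra.
  + by apply: segment => //; rewrite /mass; lra.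
  + move=> q [/= qt qh]; move: z1t z2t qt; rewrite /= !in_itv/= => z1t z2t qt.
    have [| | | | | |//] := @far_from_line R L rho z1 z2 q lineL rho0.
    * by rewrite z1h z2h.
    * lra.
    * by rewrite qh z1h.
    * by rewrite ler_norml; lra.
    * by move=> /near1.
    * by move=> /near2.
- by rewrite /mass; lra.
- by lra.
- rewrite lee_fin ge0_ler_powR ?invr_ge0 ?(ltW p0)// ?nnegrE.
  + by rewrite !mulr_ge0 ?powR_ge0// ltW.
  + by rewrite !mulr_ge0 ?powR_ge0 ?invr_ge0// ltW.
  have -> : 80^-1 `^ p / 12 * density m = 80^-1 `^ p * (4 * rho)^-1 * mass.
    by rewrite /mass; field; rewrite gt_eqF.
  rewrite ler_wpM2r//; first by rewrite /mass; lra.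
  apply: ler_pM; rewrite ?powR_ge0 ?invr_ge0//; first by lra.
    rewrite ge0_ler_powR ?(ltW p0)// ?nnegrE ?divr_ge0//; try by lra.
    by rewrite ler_pdivlMr//; lra.
  by rewrite lef_pV2 ?posrE; lra.
Qed.

(** On the radii [F k] belonging to the child [M k], the integrand is at least
    the constant [w k], and [w k] times the length of [F k] is a constant times
    [density (M k) `^ (2 / p)].  The first [K0 + 1] children are dropped, their
    teeth being too far away compared with the size of the segment around the
    point. *)
Lemma comb_set_beta_infinite (p : R) (x : R * R) : 2 < p -> comb_set x ->
  (\int[lebesgue_measure]_(r in `]0%R, 1%R[)
    (beta (outer_restr hausdorff1 comb_set) p x r ^+ 2 * (r^-1)%:E) = +oo)%E.
Proof.
case: x => t y p2 [n _ [/= nt ->]].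
have p0 : 0 < p by lra.
have [e e0 te] := comb_right_nbhd nt.
pose C : R := 80^-1 `^ p / 12.
have C0 : 0 < C by rewrite divr_gt0// powR_gt0.
have [c c0 cd] : exists2 c : R, 0 < c &
    forall m, c / m.+2%:R <= density m `^ (p^-1 * 2).
  apply: density_powR_ge.
  by rewrite mulr_gt0 ?invr_gt0//= mulrC ltr_pdivrMr// mul1r.
(* The pitch of comb [N] is less than [1 / N], hence than [e] once [N > K0]. *)
pose K0 := Num.truncn e^-1.
have small k : pitch (child n (k + K0.+1)) <= e.
  have [N NE] : {N | N = child n (k + K0.+1)} by exists (child n (k + K0.+1)).
  have KN : (K0 < N)%N.
    by have := child_gt n (k + K0.+1); rewrite NE; lia.
  rewrite -NE; apply/ltW; rewrite -[ltRHS]invrK /pitch exprVn.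
  rewrite ltf_pV2 ?posrE ?invr_gt0 ?exprn_gt0//.
  apply: lt_le_trans (truncnS_gt _) _.
  by rewrite -natrX ler_nat (leq_trans KN)// ltnW// ltn_expl.
pose M k := child n (k + K0.+1).
have M1 k : (1 < M k)%N by have := child_gt n (k + K0.+1); rewrite /M; lia.
have Mlt j k : (j < k)%N -> (M j < M k)%N.
  by move=> jk; apply: child_lt; rewrite ltn_add2r.
pose F k : set R := `[2 * pitch (M k), 4 * pitch (M k)[%classic.
pose w k : R :=
  C `^ (p^-1 * 2) * density (M k) `^ (p^-1 * 2) / (4 * pitch (M k)).
have w0 k : 0 <= w k.
  by rewrite !mulr_ge0 ?powR_ge0// invr_ge0 mulr_ge0// ltW// pitch_gt0.
have beta0 r :
    (0 <= beta (outer_restr hausdorff1 comb_set) p (t, height n) r)%E.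
  by apply: le_ereal_inf_tmp => _ [L _ <-]; exact: poweR_ge0.
apply/eqyP => A A0.
pose b : R := C `^ (p^-1 * 2) * (c / (2 ^ n.+2)%:R) / 2.
have b0 : 0 < b.
  by rewrite divr_gt0// mulr_gt0 ?powR_gt0// divr_gt0// ltr0n expn_gt0.
have [N AN] := @harmonic_block_unbounded R (A / b) K0.+1.
apply: (@le_trans _ _
    (\sum_(k < N) (w k)%:E * lebesgue_measure (F k))%E); last first.
  apply: integral_ge_sum.
  - move=> r; rewrite /= in_itv/= => /andP[r0 _].
    by rewrite !mule_ge0// lee_fin invr_ge0 ltW.
  - by move=> k; exact: measurable_itv.
  - move=> k r; rewrite /F/= !in_itv/= => /andP[r1 r2].
    rewrite (lt_le_trans _ r1) ?mulr_gt0 ?pitch_gt0//=.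
    have := pitch_le (M1 k); have := pitchS 0; have := pitchS 1.
    have : pitch 0 = 1 by []. lra.
  - have disj j k : (j < k)%N -> F j `&` F k = set0.
      move=> /Mlt jk; apply/seteqP; split=> // r [].
      rewrite /F/= !in_itv/= => /andP[r1 _] /andP[_ r2].
      by have := pitch_le jk; have := pitchS (M j); lra.
    apply/trivIsetP => j k _ _.
    by case: ltngtP => // jk _; [|rewrite setIC]; exact: disj.
  - exact: w0.
  - move=> k r; rewrite /F/= in_itv/= => /andP[r1 r2].
    have r0 : 0 < r by rewrite (lt_le_trans _ r1)// mulr_gt0// pitch_gt0.
    have lb : (((C * density (M k)) `^ p^-1)%:E <=
          beta (outer_restr hausdorff1 comb_set) p (t, height n) r)%E.
        apply: beta_comb_set => //.
      + by rewrite (ltn_trans _ (M1 k)).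
      + exact: parent_child.
      + apply: subset_trans te => s /=; rewrite !in_itv/= => /andP[-> st]/=.
        by rewrite (lt_le_trans st)// lerD2l small.
      + by rewrite r1.
    have -> : w k = ((C * density (M k)) `^ p^-1) ^+ 2 * (4 * pitch (M k))^-1.
      rewrite /w -powR_mulrn ?powR_ge0// -powRrM powRM//; first exact: ltW.
      by rewrite ltW// density_gt0.
    rewrite EFinM; apply: lee_pmul.
    + by rewrite lee_fin sqr_ge0.
    + by rewrite lee_fin invr_ge0 mulr_ge0// ltW// pitch_gt0.
    + by rewrite EFin_expe !expe2 lee_pmul// ?lee_fin ?powR_ge0.
    + by rewrite lee_fin lef_pV2 ?posrE ?ltW// mulr_gt0// pitch_gt0.
have FE k : ((w k)%:E * lebesgue_measure (F k) =
    (C `^ (p^-1 * 2) * density (M k) `^ (p^-1 * 2) / 2)%:E)%E.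
  have pp := pitch_gt0 (M k).
  rewrite /F lebesgue_measure_itv/= lte_fin ltr_pM2r// ltr_nat/= -EFinB -EFinM.
  by congr _%:E; rewrite /w; field; rewrite gt_eqF.
under eq_bigr do rewrite FE.
rewrite sumEFin lee_fin.
have -> : A = b * (A / b) by rewrite mulrC divfK// gt_eqF.
apply: le_trans (ler_wpM2l (ltW b0) AN) _; rewrite mulr_sumr.
apply: ler_sum => k _; rewrite /b mulrAC ler_wpM2r ?invr_ge0//.
rewrite -mulrA ler_wpM2l ?powR_ge0//.
apply: le_trans (cd (M k)); rewrite -mulrA ler_wpM2l ?(ltW c0)//.
rewrite -invfM lef_pV2 ?posrE ?mulr_gt0 ?ltr0n ?expn_gt0//.
by rewrite -natrM ler_nat child_le.
Qed.

End combs.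

Theorem theorem1p2 (R : realType) :
  exists E : set (R * R),
    [/\ (0 < hausdorff1 E)%E, (hausdorff1 E < +oo)%E, rectifiable_set E &
      forall p : R, 2 < p ->
        {ae hausdorff1, forall x : R * R, E x ->
          (\int[lebesgue_measure]_(r in `]0%R, 1%R[)
            (beta (outer_restr hausdorff1 E) p x r ^+ 2 * (r^-1)%:E) = +oo)%E}].
Proof.
exists comb_set; split.
- exact: hausdorff1_comb_set_gt0.
- exact: hausdorff1_comb_set_finite.
- exact: rectifiable_comb_set.
- move=> p p2; exists set0; split; [exact: measurable0|exact: hausdorff10|].
  by move=> x; apply: contra_notP => _ Ex; exact: comb_set_beta_infinite.
Qed.
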